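(* Let $F$ be a Finsler metric on a manifold $M$ of dimension $n\ge2$, with Weyl curvature $W$ and Douglas curvature $D$. Then $$W_j{}^i{}_{ml.k}\,y^m=D_j{}^i{}_{kl|0}-\frac1{n+1}\theta_{jkl}\,y^i,$$ where $$\theta_{jkl}=2E_{jk|l}-\frac13\big(R^s{}_{l.s}-(n+2)R_{.l}\big)_{.j.k}.$$
   Context: Let $F$ be a Finsler metric on an $n$-dimensional manifold $M$ with standard local coordinates $(x^i,y^i)$ on $TM$; all tensors below live on $TM\setminus\{0\}$. A subscript ''$._k$'' denotes $\partial/\partial y^k$. The spray coefficients are $G^i=\frac14 g^{il}\{(F^2)_{x^ky^l}y^k-(F^2)_{x^l}\}$, where $g_{ij}=\frac12(F^2)_{y^iy^j}$. A subscript ''$|_m$'' denotes the horizontal covariant derivative of the Berwald connection of $F$; e.g. with $N^r{}_m=G^r{}_{.m}$ and $G^i{}_{rm}=G^i{}_{.r.m}$, $T^i{}_{j|m}=\partial_{x^m}T^i{}_j-N^r{}_mT^i{}_{j.r}+G^i{}_{rm}T^r{}_j-G^r{}_{jm}T^i{}_r$, and similarly for other tensors. The subscript $0$ denotes contraction with $y$, e.g. $T_{|0}=T_{|m}y^m$. Riemann curvature: $R^i{}_k=2\frac{\partial G^i}{\partial x^k}-\frac{\partial^2G^i}{\partial x^m\partial y^k}y^m+2G^m\frac{\partial^2G^i}{\partial y^m\partial y^k}-\frac{\partial G^i}{\partial y^m}\frac{\partial G^m}{\partial y^k}$; and $R=\frac1{n-1}R^m{}_m$. Weyl curvature: $W^i{}_k=A^i{}_k-\frac1{n+1}A^m{}_{k.m}y^i$,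 where $A^i{}_k=R^i{}_k-R\,\delta^i{}_k$. Set $W_j{}^i{}_{kl}=\frac13\big(W^i{}_{k.l}-W^i{}_{l.k}\big)_{.j}$; then $W_j{}^i{}_{ml.k}=\partial W_j{}^i{}_{ml}/\partial y^k$. Berwald curvature: $B_j{}^i{}_{kl}=\frac{\partial^3G^i}{\partial y^j\partial y^k\partial y^l}$. Mean Berwald curvature: $E_{jk}=\frac12B_j{}^m{}_{km}$. Douglas curvature: $D_j{}^i{}_{kl}=B_j{}^i{}_{kl}-\frac1{n+1}\frac{\partial^3}{\partial y^j\partial y^k\partial y^l}\Big(\frac{\partial G^m}{\partial y^m}y^i\Big)$. *)

(* Defs.v *)
(* Built on MathComp-Analysis. *)
From HB Require Import structures.
From mathcomp Require Import all_boot all_order all_algebra.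
From mathcomp Require Import all_classical all_reals all_analysis.

Set Implicit Arguments.
Unset Strict Implicit.
Unset Printing Implicit Defensive.

Import Order.TTheory GRing.Theory Num.Theory.
Import numFieldNormedType.Exports.

Local Open Scope classical_set_scope.
Local Open Scope ring_scope.

Section Smoothness.
Variable R : realType.

(* For finite-dimensional [V] and open [U] this is the usual class C^k: all
   iterated directional derivatives up to order k exist and are continuous. *)
Fixpoint is_Ck (V W : normedModType R) (k : nat) (U : set V) (f : V -> W)
    {struct k} : Prop :=
  (forall p, U p -> {for p, continuous f}) /\
  match k with
  | 0 => True
  | k'.+1 => forall v : V,
      (forall p, U p -> derivable f p v) /\ is_Ck k' U ('D_v f)
  end.

Definition smooth_on (V W : normedModType R) (U : set V) (f : V -> W) : Prop :=
  forall k : nat, is_Ck k U f.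

End Smoothness.

(* [chart_inv a] is the inverse of the chart [chart_map a : chart_dom a -> R^n]; the values
   of [chart_map a] off [chart_dom a], and of [chart_inv a] off the image, are irrelevant. *)
Record smooth_manifold (R : realType) (n : nat) (M : topologicalType) :=
  SmoothManifold {
    chart : Type;
    chart_dom : chart -> set M;
    chart_map : chart -> M -> 'rV[R]_n;
    chart_inv : chart -> 'rV[R]_n -> M;
    manifold_hausdorff : hausdorff_space M;
    manifold_second_countable : @second_countable M;
    chart_cover : forall p, exists a, chart_dom a p;
    chart_dom_open : forall a, open (chart_dom a);
    chart_map_open : forall a, open (chart_map a @` chart_dom a);
    chart_mapK : forall a p, chart_dom a p -> chart_inv a (chart_map a p) = p;
    chart_map_continuous : forall a, {within chart_dom a, continuous (chart_map a)};
    chart_inv_continuous :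
      forall a, {within chart_map a @` chart_dom a, continuous (chart_inv a)};
    transition_smooth : forall a b,
      smooth_on (chart_map a @` (chart_dom a `&` chart_dom b)) (chart_map b \o chart_inv a)
  }.

Section LocalCoordinates.
Variables (R : realType) (n : nat).

Local Notation vec := 'rV[R]_n.

(* A function of the standard coordinates (x^i, y^i) on TM over one chart. *)
Definition tfun : Type := vec -> vec -> R.

Definition dx (k : 'I_n) (f : tfun) : tfun :=
  fun x y => 'D_(delta_mx 0 k : vec) (fun x' => f x' y) x.

Definition dy (k : 'I_n) (f : tfun) : tfun :=
  fun x y => 'D_(delta_mx 0 k : vec) (fun y' => f x y') y.

(* Index arguments are listed from left to right as in the tensor notation:
   [riemann i k] is R^i_k, [Gcoef i r m] is G^i_{rm}, [weyl4 j i k l] is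
   W_j^i_{kl}, and so on.  Successive subscripts ".a.b" mean [dy b (dy a _)]. *)
Section Metric.
Variable F : tfun.

Definition Fsq : tfun := fun x y => F x y ^+ 2.

Definition fundamental (i j : 'I_n) : tfun :=
  fun x y => 2^-1 * dy j (dy i Fsq) x y.

Definition fundamental_mx (x y : vec) : 'M[R]_n :=
  \matrix_(i < n, j < n) fundamental i j x y.

Definition spray (i : 'I_n) : tfun := fun x y =>
  4^-1 * \sum_(l < n) invmx (fundamental_mx x y) i l *
    (\sum_(k < n) dy l (dx k Fsq) x y * y 0 k - dx l Fsq x y).

Definition Ncoef (i m : 'I_n) : tfun := dy m (spray i).

Definition Gcoef (i r m : 'I_n) : tfun := dy m (dy r (spray i)).

(* Horizontal Berwald derivative T_{jk|m} of a (0,2)-tensor T_{jk} = T j k. *)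
Definition hcov02 (T : 'I_n -> 'I_n -> tfun) (j k m : 'I_n) : tfun :=
  fun x y =>
    dx m (T j k) x y
    - \sum_(r < n) Ncoef r m x y * dy r (T j k) x y
    - \sum_(r < n) Gcoef r j m x y * T r k x y
    - \sum_(r < n) Gcoef r k m x y * T j r x y.

(* Horizontal Berwald derivative T_j^i_{kl|m} of a (1,3)-tensor
   T_j^i_{kl} = T j i k l; the second index is the contravariant one. *)
Definition hcov13 (T : 'I_n -> 'I_n -> 'I_n -> 'I_n -> tfun)
    (j i k l m : 'I_n) : tfun :=
  fun x y =>
    dx m (T j i k l) x y
    - \sum_(r < n) Ncoef r m x y * dy r (T j i k l) x y
    + \sum_(r < n) Gcoef i r m x y * T j r k l x y
    - \sum_(r < n) Gcoef r j m x y * T r i k l x y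
    - \sum_(r < n) Gcoef r k m x y * T j i r l x y
    - \sum_(r < n) Gcoef r l m x y * T j i k r x y.

Definition riemann (i k : 'I_n) : tfun := fun x y =>
  2 * dx k (spray i) x y
  - \sum_(m < n) dx m (dy k (spray i)) x y * y 0 m
  + 2 * (\sum_(m < n) spray m x y * dy m (dy k (spray i)) x y)
  - \sum_(m < n) dy m (spray i) x y * dy k (spray m) x y.

Definition Rscal : tfun := fun x y =>
  (n%:R - 1)^-1 * \sum_(m < n) riemann m m x y.

Definition Amat (i k : 'I_n) : tfun := fun x y =>
  riemann i k x y - Rscal x y * (i == k)%:R.

Definition weyl (i k : 'I_n) : tfun := fun x y =>
  Amat i k x y - (n%:R + 1)^-1 * (\sum_(m < n) dy m (Amat m k) x y) * y 0 i.

Definition weyl4 (j i k l : 'I_n) : tfun := fun x y =>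
  3^-1 * dy j (fun x' y' => dy l (weyl i k) x' y' - dy k (weyl i l) x' y') x y.

Definition berwald (j i k l : 'I_n) : tfun := dy j (dy k (dy l (spray i))).

Definition mean_berwald (j k : 'I_n) : tfun := fun x y =>
  2^-1 * \sum_(m < n) berwald j m k m x y.

Definition douglas (j i k l : 'I_n) : tfun := fun x y =>
  berwald j i k l x y
  - (n%:R + 1)^-1 *
    dy j (dy k (dy l (fun x' y' =>
      (\sum_(m < n) dy m (spray m) x' y') * y' 0 i))) x y.

Definition douglas_h0 (j i k l : 'I_n) : tfun := fun x y =>
  \sum_(m < n) hcov13 douglas j i k l m x y * y 0 m.

Definition theta (j k l : 'I_n) : tfun := fun x y =>
  2 * hcov02 mean_berwald j k l x y
  - 3^-1 * dy k (dy j (fun x' y' =>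
      \sum_(s < n) dy s (riemann s l) x' y'
      - (n%:R + 2) * dy l Rscal x' y')) x y.

End Metric.

Definition finsler_on (U : set vec) (F : tfun) : Prop :=
  [/\ forall x y, U x -> 0 <= F x y,
      smooth_on [set p : vec * vec | U p.1 /\ p.2 != 0]
                (fun p => F p.1 p.2),
      forall x y (c : R), U x -> 0 < c -> F x (c *: y) = c * F x y
    & forall x y (v : vec), U x -> y != 0 -> v != 0 ->
        0 < \sum_(i < n) \sum_(j < n) fundamental F i j x y * v 0 i * v 0 j].

End LocalCoordinates.

(* A function on TM is the family of its expressions [F a x y] in the standard
   local coordinates of the charts [a], where (x, y) in [a] and
   (tau x, dtau_x y) in [b] are the same tangent vector, tau being the
   transition map from [a] to [b]. *)
Definition finsler_metric (R : realType) (n : nat) (M : topologicalType)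
    (A : smooth_manifold R n M) (F : chart A -> tfun R n) : Prop :=
  (forall a, finsler_on (chart_map a @` chart_dom a) (F a)) /\
  (forall a b (x y : 'rV[R]_n), (chart_map a @` (chart_dom a `&` chart_dom b)) x ->
     let tau := chart_map b \o chart_inv a in
     F b (tau x) ('D_y tau x) = F a x y).

(* Main.v *)
Require Import Defs.
From HB Require Import structures.
From mathcomp Require Import all_boot all_order all_algebra.
From mathcomp Require Import all_classical all_reals all_analysis.
From mathcomp Require Import ring lra.

(* The identity is purely algebraic in the spray.  The functions on the slit
   tangent bundle of a chart that are smooth form a commutative ring with
   commuting derivations d/dx^k, d/dy^k (Schwarz), in which Euler's relation for
   F gives G^i_{.m} y^m = 2 G^i.  If P_m is 2-homogeneous in y and P_m y^m = 0,
   then (P_{m.l} - P_{l.m})_{.j.k} y^m = - (P_{l.j.k} + P_{j.l.k} + P_{k.l.j}).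
   For P_m = W^i_m this reduces the left-hand side to the cyclic sum of W^i; the
   cyclic sum of R^i_{l.j.k} is -3 B_j^i_{kl|0}, and its trace over i = l
   identifies the remaining terms with e_{jk|0}, e = G^m_{.m}, and with its
   derivative (e_{jk|0})_{.l} = e_{jkl|0} + e_{jk|l}. *)

Import Order.TTheory GRing.Theory Num.Theory.
Import numFieldNormedType.Exports.

Local Open Scope classical_set_scope.
Local Open Scope ring_scope.

Set Implicit Arguments.
Unset Strict Implicit.
Unset Printing Implicit Defensive.

(** * Functions of class C^k *)

Section SmoothFunctions.
Context {R : realType} {V : normedModType R}.
Implicit Types (U : set V) (f g : V -> R).

Lemma is_Ck_continuous k U f : is_Ck k U f ->
  forall p, U p -> {for p, continuous f}.
Proof. by case: k => [|k] []. Qed.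

Lemma is_Ck_derivable k U f : is_Ck k.+1 U f ->
  forall v p (Up : U p), derivable f p v.
Proof. by move=> [_ +] v p Up => /(_ v) [+ _]; exact. Qed.

Lemma is_Ck_derive k U f v : is_Ck k.+1 U f -> is_Ck k U ('D_v f).
Proof. by move=> [_ /(_ v) []]. Qed.

Lemma is_CkW k U f : is_Ck k.+1 U f -> is_Ck k U f.
Proof.
elim: k f => [|k IHk] f [cf df]; first by split.
by split=> // v; have [? ?] := df v; split=> //; exact: IHk.
Qed.

Lemma is_Ck_subset k U U' f : U' `<=` U -> is_Ck k U f -> is_Ck k U' f.
Proof.
move=> sU; elim: k f => [|k IHk] f [cf df]; split=> //;
  try by move=> p /sU; exact: cf.
by move=> v; have [dfv /IHk] := df v; split=> // p /sU; exact: dfv.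
Qed.

Lemma near_open_eq U f g : open U -> {in U, f =1 g} ->
  forall p, U p -> \forall q \near p, f q = g q.
Proof.
move=> oU fg p Up; have : nbhs p U by exact: open_nbhs_nbhs.
by apply: filterS => q Uq; apply: fg; exact: mem_set.
Qed.

Lemma is_Ck_unfold k U f : (forall p, U p -> {for p, continuous f}) ->
  (forall k', k = k'.+1 -> forall v,
    (forall p, U p -> derivable f p v) /\ is_Ck k' U ('D_v f)) ->
  is_Ck k U f.
Proof. by case: k => [|k] cf df; split=> //; exact: df. Qed.

Lemma eq_is_Ck k U f g : open U -> {in U, f =1 g} ->
  is_Ck k U f -> is_Ck k U g.
Proof.
move=> oU; elim/ltn_ind: k f g => k IHk f g fg Cf.
apply: is_Ck_unfold => [p Up|k' k'E v].
  rewrite /prop_for /continuous_at -(fg p (mem_set Up)).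
  apply: cvg_trans (is_Ck_continuous Cf Up).
  by apply: near_eq_cvg; exact: near_open_eq fg p Up.
subst k; split=> [p Up|].
  apply: (near_eq_derivable (near_open_eq oU fg Up)).
  exact: (is_Ck_derivable Cf Up).
apply: IHk (is_Ck_derive v Cf) => // p /set_mem Up.
by apply: near_eq_derive; exact: near_open_eq fg p Up.
Qed.

Lemma is_Ck_cst k U (a : R) : is_Ck k U (cst a).
Proof.
elim/ltn_ind: k a => k IHk a; apply: is_Ck_unfold => [p _|k' k'E v].
  exact: cvg_cst.
subst k; split=> [p _|]; first exact: derivable_cst.
suff -> : 'D_v (cst a : V -> R) = cst 0 by exact: IHk.
by apply/funext => p; rewrite derive_cst.
Qed.

Lemma is_CkD k U f g : open U -> is_Ck k U f -> is_Ck k U g ->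
  is_Ck k U (f + g).
Proof.
move=> oU; elim/ltn_ind: k f g => k IHk f g Cf Cg.
apply: is_Ck_unfold => [p Up|k' k'E v].
  exact: (continuousD (is_Ck_continuous Cf Up) (is_Ck_continuous Cg Up)).
subst k; split=> [p Up|].
  exact: (derivableD (is_Ck_derivable Cf Up) (is_Ck_derivable Cg Up)).
apply: eq_is_Ck (IHk _ _ _ _ (is_Ck_derive v Cf) (is_Ck_derive v Cg)) => //.
move=> p /set_mem Up.
by rewrite (deriveD (is_Ck_derivable Cf Up) (is_Ck_derivable Cg Up)).
Qed.

Lemma is_CkM k U f g : open U -> is_Ck k U f -> is_Ck k U g ->
  is_Ck k U (f * g).
Proof.
move=> oU; elim/ltn_ind: k f g => k IHk f g Cf Cg.
apply: is_Ck_unfold => [p Up|k' k'E v].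
  exact: (continuousM (is_Ck_continuous Cf Up) (is_Ck_continuous Cg Up)).
subst k; split=> [p Up|].
  exact: (derivableM (is_Ck_derivable Cf Up) (is_Ck_derivable Cg Up)).
apply: eq_is_Ck (is_CkD oU (IHk k' _ _ _ (is_CkW Cf) (is_Ck_derive v Cg))
    (IHk k' _ _ _ (is_CkW Cg) (is_Ck_derive v Cf))) => //.
move=> p /set_mem Up.
by rewrite (deriveM (is_Ck_derivable Cf Up) (is_Ck_derivable Cg Up)).
Qed.

Lemma is_CkV k U f : open U -> {in U, forall p, f p != 0} -> is_Ck k U f ->
  is_Ck k U (fun p => (f p)^-1).
Proof.
move=> oU f0; elim/ltn_ind: k => k IHk Cf.
apply: is_Ck_unfold => [p Up|k' k'E v].
  by apply: continuousV; [exact/f0/mem_set|exact: (is_Ck_continuous Cf)].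
subst k; split=> [p Up|].
  by apply: derivableV; [exact/f0/mem_set|exact: (is_Ck_derivable Cf)].
have CV := IHk k' (ltnSn _) (is_CkW Cf).
apply: eq_is_Ck (is_CkM oU (is_CkM oU (is_Ck_cst k' U (-1))
  (is_CkM oU CV CV)) (is_Ck_derive v Cf)) => // p pU.
rewrite deriveV ?f0 //; last exact: (is_Ck_derivable Cf (set_mem pU)).
by rewrite !mulrfctE /cst /= -expr2 exprVn mulN1r.
Qed.

End SmoothFunctions.

Section DirectionalDerivatives.
Context {R : realType} {V : normedModType R}.
Implicit Types (U : set V) (f g : V -> R) (p q r u v w z : V).

Lemma derive_line f p v (a : R) :
  'D_(a *: v) f p = 'D_a (fun t : R => f (t *: v + p)) 0.
Proof.
rewrite /derive; set g1 := fun h => h^-1 *: _; set g2 := fun h => h^-1 *: _.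
suff -> : g1 = g2 by [].
apply/funext => h; rewrite /g1 /g2 /=.
by rewrite scale0r add0r addr0 scalerA.
Qed.

Lemma derive_scale f p v (a : R) : derivable f p v ->
  'D_(a *: v) f p = a * 'D_v f p.
Proof.
move=> /derivable1P /derivable1_diffP df.
have E1 := derive_line f p v 1; rewrite scale1r in E1.
by rewrite E1 derive_line !deriveE // -[X in 'd _ _ X]mulr1 linearZ.
Qed.

Lemma derive_mvt f p u :
  (forall s : R, 0 <= s <= 1 -> derivable f (s *: u + p) u) ->
  exists2 s : R, 0 <= s <= 1 & f (u + p) - f p = 'D_u f (s *: u + p).
Proof.
move=> df; pose phi (s : R) := f (s *: u + p).
have shift_phi s : (fun h : R => h^-1 *: ((phi \o shift s) (h *: 1) - phi s)) =
    (fun h => h^-1 *: ((f \o shift (s *: u + p)) (h *: u) - f (s *: u + p))).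
  by apply/funext => h; rewrite /phi /= [h *: 1]mulr1 scalerDl addrA.
have dphi (s : R) : 0 <= s <= 1 -> is_derive s 1 phi ('D_u f (s *: u + p)).
  by move=> /df dfs; split; rewrite /derivable /derive shift_phi.
have [||s /itvP s01] := @MVT_segment R phi (fun s => 'D_u f (s *: u + p)) 0 1 ler01.
- by move=> s s01; apply: dphi; rewrite !ltW ?(itvP s01).
- apply: derivable_within_continuous => s s01.
  by have [] := dphi s; rewrite ?s01 // !(itvP s01).
rewrite /phi subr0 mulr1 scale1r scale0r add0r => ->.
by exists s; rewrite // !s01.
Qed.

Lemma ball_segment p q u (e s : R) : ball p e q -> ball p e (u + q) ->
  0 <= s <= 1 -> ball p e (s *: u + q).
Proof.
rewrite -!ball_normE /= => pq puq /andP[s0 s1].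
have -> : p - (s *: u + q) = s *: (p - (u + q)) + (1 - s) *: (p - q).
  rewrite !opprD ![p + (- _ - q)]addrCA ![- _ + _]addrC.
  by rewrite scalerBl scale1r scalerBr [RHS]addrC addrA subrK.
apply: le_lt_trans (ler_normD _ _) _; rewrite !normrZ ger0_norm //.
rewrite (ger0_norm (_ : 0 <= 1 - s)) ?subr_ge0 //.
have [->|sn0] := eqVneq s 0; first by rewrite mul0r add0r subr0 mul1r.
have s_gt0 : 0 < s by rewrite lt_def sn0.
rewrite -[ltRHS](_ : s * e + (1 - s) * e = e); last by ring.
by rewrite ltr_leD ?ltr_pM2l // ler_wpM2l ?subr_ge0 // ltW.
Qed.

Lemma derive_mvt_ball f p q u (e : R) :
  (forall r, ball p e r -> derivable f r u) -> ball p e q -> ball p e (u + q) ->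
  exists2 r, ball p e r & f (u + q) - f q = 'D_u f r.
Proof.
move=> df pq puq.
have [s s01|s s01 ->] := @derive_mvt f q u; first exact/df/ball_segment.
by exists (s *: u + q) => //; exact: ball_segment.
Qed.

Lemma ball_small_steps p v w (e : R) : 0 < e -> exists2 h : R, 0 < h &
  [/\ ball p e (h *: v + p), ball p e (h *: w + p)
    & ball p e (h *: v + (h *: w + p))].
Proof.
move=> e0; pose d := `|v| + `|w| + 1.
have d0 : 0 < d by rewrite /d ltr_pwDr // addr_ge0.
have h0 : 0 < e / d by rewrite divr_gt0.
exists (e / d) => //; set h := e / d.
have small u : `|u| < d -> ball p e (h *: u + p).
  rewrite -ball_normE /= opprD addrCA subrr addr0 normrN normrZ gtr0_norm // => ud.
  by rewrite -[ltRHS](divfK (lt0r_neq0 d0)) ltr_pM2l.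
have [v0 w0] := (normr_ge0 v, normr_ge0 w).
split; rewrite ?addrA -?scalerDr; apply: small; rewrite /d; try lra.
by apply: le_lt_trans (ler_normD _ _) _; lra.
Qed.

(* Continuity turns relations between values at nearby intermediate points, as
   produced by the mean value theorem, into a relation at the point itself. *)
Lemma eq_at_of_near_points (g1 g2 g3 : V -> R) p :
  {for p, continuous g1} -> {for p, continuous g2} -> {for p, continuous g3} ->
  (forall e : R, 0 < e -> exists r1 r2 r3,
    [/\ ball p e r1, ball p e r2, ball p e r3 & g1 r1 = g2 r2 + g3 r3]) ->
  g1 p = g2 p + g3 p.
Proof.
move=> c1 c2 c3 near_eq; apply/eqP; rewrite -subr_eq0 -normr_le0.
apply/ler_addgt0Pr => e e0; rewrite add0r.
have e30 : 0 < e / 3 by rewrite divr_gt0.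
have near_ball g : {for p, continuous g} ->
    exists2 d : R, 0 < d & forall q, ball p d q -> `|g p - g q| < e / 3.
  move=> /cvgrPdist_lt /(_ _ e30) /nbhs_ballP[d /= d0 dq].
  by exists d.
have [d1 d10 g1d] := near_ball _ c1.
have [d2 d20 g2d] := near_ball _ c2.
have [d3 d30 g3d] := near_ball _ c3.
have d0 : 0 < Num.min d1 (Num.min d2 d3) by rewrite !lt_min d10 d20 d30.
have [r1 [r2 [r3 [b1 b2 b3 E]]]] := near_eq _ d0.
have {}g1d : `|g1 p - g1 r1| < e / 3.
  by apply/g1d/(le_ball _ b1); rewrite ge_min lexx.
have {}g2d : `|g2 p - g2 r2| < e / 3.
  by apply/g2d/(le_ball _ b2); rewrite !ge_min lexx orbT.
have {}g3d : `|g3 p - g3 r3| < e / 3.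
  by apply/g3d/(le_ball _ b3); rewrite !ge_min lexx !orbT.
move: g1d g2d g3d; rewrite !ltr_norml => /andP[? ?] /andP[? ?] /andP[? ?].
by rewrite ler_norml; apply/andP; split; lra.
Qed.

Lemma deriveDdir f U p v w : open U -> is_Ck 1 U f -> U p ->
  'D_(v + w) f p = 'D_v f p + 'D_w f p.
Proof.
move=> oU Cf Up.
have cD u : {for p, continuous ('D_u f)}.
  exact: (is_Ck_continuous (is_Ck_derive u Cf) Up).
apply: (eq_at_of_near_points (cD _) (cD _) (cD _)) => e e0.
have [d /= d0 dU] : exists2 d : R, 0 < d & ball p d `<=` U.
  exact/nbhs_ballP/open_nbhs_nbhs.
have m0 : 0 < Num.min e d by rewrite lt_min e0.
have sub_e q : ball p (Num.min e d) q -> ball p e q.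
  by apply: le_ball; rewrite ge_min lexx.
have df u r : ball p (Num.min e d) r -> derivable f r u.
  move=> br; apply: (is_Ck_derivable Cf (dU r _)).
  by apply: (le_ball _ br); rewrite ge_min lexx orbT.
have pp : ball p (Num.min e d) p by exact: ballxx.
have [h h0 [hv hw hvw]] := ball_small_steps p v w m0.
have hvw' : ball p (Num.min e d) (h *: (v + w) + p) by rewrite scalerDr -addrA.
have [r1 b1 E1] := derive_mvt_ball (df _) pp hvw'.
have [r2 b2 E2] := derive_mvt_ball (df _) hw hvw.
have [r3 b3 E3] := derive_mvt_ball (df _) pp hw.
exists r1, r2, r3; split; [exact: sub_e..|].
apply: (mulfI (lt0r_neq0 h0)); rewrite mulrDr -!derive_scale; try exact: df.
by rewrite -E1 -E2 -E3 scalerDr -(addrA (h *: v)); ring.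
Qed.

Lemma derivable_translate f q v a :
  derivable f (a + q) v -> derivable (fun r => f (a + r)) q v.
Proof.
rewrite /derivable; set g1 := fun h => h^-1 *: _; set g2 := fun h => h^-1 *: _.
suff -> : g1 = g2 by [].
by apply/funext => h; rewrite /g1 /g2 /= addrCA.
Qed.

Lemma derive_translate f q v a :
  'D_v (fun r => f (a + r)) q = 'D_v f (a + q).
Proof.
rewrite /derive; set g1 := fun h => h^-1 *: _; set g2 := fun h => h^-1 *: _.
suff -> : g1 = g2 by [].
by apply/funext => h; rewrite /g1 /g2 /= addrCA.
Qed.

Lemma second_difference_mvt f p v w (e h : R) : 0 < h ->
  is_Ck 2 (ball p e) f -> ball p e p ->
  ball p e (h *: v + p) -> ball p e (h *: w + p) ->
  ball p e (h *: v + (h *: w + p)) ->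
  exists2 r, ball p e r &
    f (h *: v + (h *: w + p)) - f (h *: w + p) - (f (h *: v + p) - f p) =
    h * h * 'D_w ('D_v f) r.
Proof.
move=> h0 Cf pp hv hw hvw.
pose psi q := f (h *: w + q) - f q.
have df u r : ball p e r -> derivable f r u.
  by move=> br; exact: (is_Ck_derivable Cf br).
have ddf u z r : ball p e r -> derivable ('D_z f) r u.
  by move=> br; exact: (is_Ck_derivable (is_Ck_derive z Cf) br).
have dfw u r : ball p e (h *: w + r) -> derivable (fun q => f (h *: w + q)) r u.
  by move=> br; exact/derivable_translate/df.
have seg (s : R) : 0 <= s <= 1 ->
    ball p e (s *: (h *: v) + p) /\ ball p e (h *: w + (s *: (h *: v) + p)).
  move=> s01; split; first exact: ball_segment.
  by rewrite addrCA; exact: ball_segment.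
have [s /seg[bs bws]|s /seg[bs bws]] := @derive_mvt psi p (h *: v).
  by apply: derivableB; [exact: dfw|exact: df].
rewrite /psi deriveB; [|exact: dfw|exact: df].
rewrite derive_translate !derive_scale; [|exact: df..].
rewrite -mulrBr.
have [r br ->] := derive_mvt_ball (ddf (h *: w) v) bs bws.
rewrite derive_scale ?mulrA; last exact: ddf.
by move=> E; exists r => //; rewrite -E [h *: w + (h *: v + p)]addrCA; ring.
Qed.

Lemma derive_comm f U p v w : open U -> is_Ck 2 U f -> U p ->
  'D_v ('D_w f) p = 'D_w ('D_v f) p.
Proof.
move=> oU Cf Up.
have cD u z : {for p, continuous ('D_u ('D_z f))}.
  exact: (is_Ck_continuous (is_Ck_derive u (is_Ck_derive z Cf)) Up).
rewrite -[RHS]addr0.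
apply: (eq_at_of_near_points (g3 := fun=> 0) (cD _ _) (cD _ _)).
  exact: cvg_cst.
move=> e e0.
have [d /= d0 dU] : exists2 d : R, 0 < d & ball p d `<=` U.
  exact/nbhs_ballP/open_nbhs_nbhs.
have m0 : 0 < Num.min e d by rewrite lt_min e0.
have sub_e q : ball p (Num.min e d) q -> ball p e q.
  by apply: le_ball; rewrite ge_min lexx.
have Cf' : is_Ck 2 (ball p (Num.min e d)) f.
  apply: is_Ck_subset Cf; apply: subset_trans dU.
  by apply: le_ball; rewrite ge_min lexx orbT.
have pp : ball p (Num.min e d) p by exact: ballxx.
have [h h0 [hv hw hvw]] := ball_small_steps p v w m0.
have hwv : ball p (Num.min e d) (h *: w + (h *: v + p)) by rewrite addrCA.
have [r1 b1 E1] := second_difference_mvt h0 Cf' pp hw hv hwv.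
have [r2 b2 E2] := second_difference_mvt h0 Cf' pp hv hw hvw.
exists r1, r2, p; split; [exact: sub_e..|].
have hh0 : h * h != 0 by rewrite mulf_neq0 // lt0r_neq0.
apply: (mulfI hh0); rewrite addr0 -[LHS]E1 -[RHS]E2.
by rewrite [h *: w + (h *: v + p)]addrCA; ring.
Qed.

End DirectionalDerivatives.

(** * Sprays in a differential ring *)

Section SprayAlgebra.
Variables (R : numFieldType) (A : comPzRingType) (c : {rmorphism R -> A}).
Variables (n : nat) (dX dY : 'I_n -> {additive A -> A}) (y G : 'I_n -> A).
Hypothesis dXM : forall k f g, dX k (f * g) = dX k f * g + f * dX k g.
Hypothesis dYM : forall k f g, dY k (f * g) = dY k f * g + f * dY k g.
Hypothesis dXc : forall k a, dX k (c a) = 0.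
Hypothesis dYc : forall k a, dY k (c a) = 0.
Hypothesis dYX : forall k l f, dY k (dX l f) = dX l (dY k f).
Hypothesis dYY : forall k l f, dY k (dY l f) = dY l (dY k f).
Hypothesis dXy : forall k i, dX k (y i) = 0.
Hypothesis dYy : forall k i, dY k (y i) = (i == k)%:R.
Hypothesis G_homogeneous : forall i, \sum_(m < n) dY m (G i) * y m = 2 * G i.

(* The [sp_] definitions are those of Defs.v read in the ring [A]: [G] is the
   spray, [dX] and [dY] are d/dx and d/dy, and [c] embeds the constants. *)
Definition sp_hcov02 (T : 'I_n -> 'I_n -> A) j k m : A :=
  dX m (T j k) - \sum_(r < n) dY m (G r) * dY r (T j k)
  - \sum_(r < n) dY m (dY j (G r)) * T r k
  - \sum_(r < n) dY m (dY k (G r)) * T j r.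

Definition sp_hcov13 (T : 'I_n -> 'I_n -> 'I_n -> 'I_n -> A) j i k l m : A :=
  dX m (T j i k l) - \sum_(r < n) dY m (G r) * dY r (T j i k l)
  + \sum_(r < n) dY m (dY r (G i)) * T j r k l
  - \sum_(r < n) dY m (dY j (G r)) * T r i k l
  - \sum_(r < n) dY m (dY k (G r)) * T j i r l
  - \sum_(r < n) dY m (dY l (G r)) * T j i k r.

Definition sp_riemann i k : A :=
  2 * dX k (G i) - \sum_(m < n) dX m (dY k (G i)) * y m
  + 2 * (\sum_(m < n) G m * dY m (dY k (G i)))
  - \sum_(m < n) dY m (G i) * dY k (G m).

Definition sp_Rscal : A := c (n%:R - 1)^-1 * \sum_(m < n) sp_riemann m m.

Definition sp_Amat i k : A := sp_riemann i k - sp_Rscal * (i == k)%:R.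

Definition sp_weyl i k : A :=
  sp_Amat i k - c (n%:R + 1)^-1 * (\sum_(m < n) dY m (sp_Amat m k)) * y i.

Definition sp_weyl4 j i k l : A :=
  c 3^-1 * dY j (dY l (sp_weyl i k) - dY k (sp_weyl i l)).

Definition sp_berwald j i k l : A := dY j (dY k (dY l (G i))).

Definition sp_mean_berwald j k : A :=
  c 2^-1 * \sum_(m < n) sp_berwald j m k m.

Definition sp_douglas j i k l : A :=
  sp_berwald j i k l
  - c (n%:R + 1)^-1 * dY j (dY k (dY l ((\sum_(m < n) dY m (G m)) * y i))).

Definition sp_douglas_h0 j i k l : A :=
  \sum_(m < n) sp_hcov13 sp_douglas j i k l m * y m.

Definition sp_theta j k l : A :=
  2 * sp_hcov02 sp_mean_berwald j k l
  - c 3^-1 * dY k (dY j (\sum_(s < n) dY s (sp_riemann s l)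
      - (n%:R + 2) * dY l sp_Rscal)).

Lemma dX_nat k m : dX k m%:R = 0.
Proof. by rewrite -(rmorph_nat c) dXc. Qed.

Lemma dY_nat k m : dY k m%:R = 0.
Proof. by rewrite -(rmorph_nat c) dYc. Qed.

Lemma dX_natl k m f : dX k (m%:R * f) = m%:R * dX k f.
Proof. by rewrite dXM dX_nat mul0r add0r. Qed.

Lemma dY_natl k m f : dY k (m%:R * f) = m%:R * dY k f.
Proof. by rewrite dYM dY_nat mul0r add0r. Qed.

Lemma dXcl k a f : dX k (c a * f) = c a * dX k f.
Proof. by rewrite dXM dXc mul0r add0r. Qed.

Lemma dYcl k a f : dY k (c a * f) = c a * dY k f.
Proof. by rewrite dYM dYc mul0r add0r. Qed.

Lemma sum_delta (f : 'I_n -> A) k : \sum_(m < n) f m * (m == k)%:R = f k.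
Proof.
rewrite (bigD1 k) //= eqxx mulr1 big1 ?addr0 // => m /negbTE ->.
by rewrite mulr0.
Qed.

Lemma dY_sum_y k (f : 'I_n -> A) :
  dY k (\sum_(m < n) f m * y m) = \sum_(m < n) dY k (f m) * y m + f k.
Proof.
rewrite raddf_sum -[in RHS](sum_delta f k) -big_split /=.
by apply: eq_bigr => m _; rewrite dYM dYy.
Qed.

Lemma dX_sum_y k (f : 'I_n -> A) :
  dX k (\sum_(m < n) f m * y m) = \sum_(m < n) dX k (f m) * y m.
Proof.
by rewrite raddf_sum /=; apply: eq_bigr => m _; rewrite dXM dXy mulr0 addr0.
Qed.

Definition homog d f := \sum_(m < n) dY m f * y m = d%:R * f.

Lemma homog_dY d k f : homog d.+1 f -> homog d (dY k f).
Proof.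
rewrite /homog => /(congr1 (dY k)); rewrite dY_sum_y dY_natl => E.
under eq_bigr do rewrite dYY.
by apply: (addIr (dY k f)); rewrite E; ring.
Qed.

Lemma homog_dX d k f : homog d f -> homog d (dX k f).
Proof.
rewrite /homog => /(congr1 (dX k)); rewrite dX_sum_y dX_natl => <-.
by apply: eq_bigr => m _; rewrite dYX.
Qed.

Lemma homogD d f g : homog d f -> homog d g -> homog d (f + g).
Proof.
rewrite /homog mulrDr => <- <-; rewrite -big_split /=.
by apply: eq_bigr => m _; rewrite raddfD mulrDl.
Qed.

Lemma homogM d e f g : homog d f -> homog e g -> homog (d + e) (f * g).
Proof.
rewrite /homog natrD => Ef Eg.
have -> : (d%:R + e%:R) * (f * g) = d%:R * f * g + f * (e%:R * g) by ring.
rewrite -Ef -Eg mulr_suml mulr_sumr -big_split /=.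
by apply: eq_bigr => m _; rewrite dYM; ring.
Qed.

Lemma homog_c a : homog 0 (c a).
Proof. by rewrite /homog mul0r big1 // => m _; rewrite dYc mul0r. Qed.

Lemma homog_nat m : homog 0 m%:R.
Proof. by rewrite -(rmorph_nat c); exact: homog_c. Qed.

Lemma homogN d f : homog d f -> homog d (- f).
Proof.
rewrite /homog mulrN => <-; rewrite -sumrN.
by apply: eq_bigr => m _; rewrite raddfN mulNr.
Qed.

Lemma homog_sum d (f : 'I_n -> A) :
  (forall m, homog d (f m)) -> homog d (\sum_(m < n) f m).
Proof.
move=> Ef; elim/big_ind: _ => // [|g h]; last exact: homogD.
by rewrite /homog mulr0 big1 // => m _; rewrite raddf0 mul0r.
Qed.

Lemma homog_y i : homog 1 (y i).
Proof.
rewrite /homog mul1r -[RHS](sum_delta y i).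
by apply: eq_bigr => m _; rewrite dYy mulrC eq_sym.
Qed.

Lemma homog_inverse (g h : 'I_n -> 'I_n -> A) :
  (forall i j, homog 0 (g i j)) ->
  (forall i k, \sum_(j < n) h i j * g j k = (i == k)%:R) ->
  (forall i k, \sum_(j < n) g i j * h j k = (i == k)%:R) ->
  forall i j, homog 0 (h i j).
Proof.
move=> g0 hg gh i l; rewrite /homog mul0r.
pose Eh j := \sum_(m < n) dY m (h i j) * y m.
have Ehg k : \sum_(j < n) Eh j * g j k = 0.
  transitivity (\sum_(m < n) dY m (\sum_(j < n) h i j * g j k) * y m); last first.
    by rewrite hg big1 // => m _; rewrite dY_nat mul0r.
  under [RHS]eq_bigr do rewrite raddf_sum mulr_suml.
  rewrite exchange_big; apply: eq_bigr => j _ /=.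
  have E0 : h i j * (\sum_(m < n) dY m (g j k) * y m) = 0.
    by rewrite [X in _ * X]g0 mul0r mulr0.
  rewrite -[LHS]addr0 -[X in _ + X = _]E0 /Eh.
  rewrite mulr_suml mulr_sumr -big_split.
  apply: eq_bigr => m _ /=.
  by rewrite dYM; ring.
transitivity (\sum_(k < n) (\sum_(j < n) Eh j * g j k) * h k l).
  under [RHS]eq_bigr do rewrite mulr_suml.
  rewrite exchange_big -/(Eh l) -(sum_delta Eh); apply: eq_bigr => j _ /=.
  by rewrite -gh mulr_sumr; apply: eq_bigr => k _; rewrite mulrA.
by rewrite big1 // => k _; rewrite Ehg mul0r.
Qed.

Lemma homog_metric_spray L (h : 'I_n -> A) :
  homog 2 L -> (forall l, homog 0 (h l)) ->
  homog 2 (c 4^-1 * \sum_(l < n) h l *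
    (\sum_(k < n) dY l (dX k L) * y k - dX l L)).
Proof.
move=> hL hh; apply: (@homogM 0 2) (homog_c _) _; apply: homog_sum => l.
apply: (@homogM 0 2) => //; apply: homogD; last exact/homogN/homog_dX.
apply: homog_sum => k; apply: (@homogM 1 1) (homog_y k).
exact/homog_dY/homog_dX.
Qed.

Lemma homog_G i : homog 2 (G i).
Proof. exact: G_homogeneous. Qed.

Hint Resolve homog_G homog_y homog_c homog_nat : core.

Lemma homog_riemann i k : homog 2 (sp_riemann i k).
Proof.
rewrite /sp_riemann; apply: homogD; [apply: homogD; [apply: homogD|]|].
- exact: (@homogM 0 2) (homog_nat 2) (homog_dX _ (homog_G i)).
- apply/homogN/homog_sum => m; apply: (@homogM 1 1) (homog_y m).
  exact/homog_dX/homog_dY.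
- apply: (@homogM 0 2) (homog_nat 2) _; apply: homog_sum => m.
  by apply: (@homogM 2 0) => //; exact/homog_dY/homog_dY.
- by apply/homogN/homog_sum => m; apply: (@homogM 1 1); exact: homog_dY.
Qed.

Lemma homog_Rscal : homog 2 sp_Rscal.
Proof.
apply: (@homogM 0 2) (homog_c _) _; apply: homog_sum => m.
exact: homog_riemann.
Qed.

Lemma riemann_y i : \sum_(k < n) sp_riemann i k * y k = 0.
Proof.
have E1 : \sum_(k < n) (\sum_(m < n) dX m (dY k (G i)) * y m) * y k =
    2 * \sum_(m < n) dX m (G i) * y m.
  under eq_bigr do rewrite mulr_suml.
  rewrite exchange_big mulr_sumr /=; apply: eq_bigr => m _.
  rewrite mulrA -dX_natl -G_homogeneous dX_sum_y mulr_suml.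
  by apply: eq_bigr => k _; rewrite mulrAC.
have E2 : \sum_(k < n) (\sum_(m < n) G m * dY m (dY k (G i))) * y k =
    \sum_(m < n) G m * dY m (G i).
  under eq_bigr do rewrite mulr_suml.
  rewrite exchange_big; apply: eq_bigr => m _ /=.
  rewrite -[dY m (G i)]mul1r -(homog_dY m (homog_G i)) mulr_sumr.
  by apply: eq_bigr => k _; rewrite dYY mulrA.
have E3 : \sum_(k < n) (\sum_(m < n) dY m (G i) * dY k (G m)) * y k =
    2 * \sum_(m < n) G m * dY m (G i).
  under eq_bigr do rewrite mulr_suml.
  rewrite exchange_big mulr_sumr; apply: eq_bigr => m _ /=.
  rewrite mulrA -G_homogeneous mulr_suml.
  by apply: eq_bigr => k _; ring.
have -> : \sum_(k < n) sp_riemann i k * y k =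
    2 * (\sum_(m < n) dX m (G i) * y m)
    - \sum_(k < n) (\sum_(m < n) dX m (dY k (G i)) * y m) * y k
    + 2 * (\sum_(k < n) (\sum_(m < n) G m * dY m (dY k (G i))) * y k)
    - \sum_(k < n) (\sum_(m < n) dY m (G i) * dY k (G m)) * y k.
  rewrite !mulr_sumr -!sumrN -!big_split /=.
  by apply: eq_bigr => k _; rewrite /sp_riemann; ring.
by rewrite E1 E2 E3; ring.
Qed.

Definition cyc (P : 'I_n -> A) j k l : A :=
  dY k (dY j (P l)) + dY k (dY l (P j)) + dY j (dY l (P k)).

Lemma cyc_contract (P : 'I_n -> A) j k l : (forall m, homog 2 (P m)) ->
  \sum_(m < n) P m * y m = 0 ->
  \sum_(m < n) dY k (dY j (dY l (P m) - dY m (P l))) * y m = - cyc P j k l.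
Proof.
move=> hP P0.
have E1 : \sum_(m < n) dY k (dY j (dY l (P m))) * y m = - cyc P j k l.
  have := congr1 (fun f => dY k (dY j (dY l f))) P0.
  rewrite /= dY_sum_y raddfD /= dY_sum_y !raddfD /= dY_sum_y !raddf0 => E.
  by apply/eqP; rewrite -subr_eq0 -[X in _ == X]E /cyc; apply/eqP; ring.
have E2 : \sum_(m < n) dY k (dY j (dY m (P l))) * y m = 0.
  rewrite -[RHS](mul0r (dY k (dY j (P l)))) -(homog_dY k (homog_dY j (hP l))).
  by apply: eq_bigr => m _; rewrite (dYY j m) (dYY k m).
rewrite -E1 -[RHS]subr0 -[X in _ - X]E2 -sumrB.
by apply: eq_bigr => m _; rewrite !raddfB mulrBl.
Qed.

(* B_j^i_{kl|0} *)
Definition berwald_h0 j i k l : A := \sum_(m < n)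
  (dX m (sp_berwald j i k l) * y m - 2 * (G m * dY m (sp_berwald j i k l))
   + dY m (G i) * sp_berwald j m k l - dY j (G m) * sp_berwald m i k l
   - dY k (G m) * sp_berwald j i m l - dY l (G m) * sp_berwald j i k m).

Lemma dYY_sumM j k (f g : 'I_n -> A) :
  dY k (dY j (\sum_(m < n) f m * g m)) = \sum_(m < n)
    (dY k (dY j (f m)) * g m + dY j (f m) * dY k (g m)
     + dY k (f m) * dY j (g m) + f m * dY k (dY j (g m))).
Proof.
rewrite !raddf_sum /=; apply: eq_bigr => m _.
by rewrite dYM raddfD /= !dYM !addrA.
Qed.

Lemma dYY_sum_dX j k f :
  dY k (dY j (\sum_(m < n) dX m f * y m)) =
  \sum_(m < n) dX m (dY k (dY j f)) * y m + dX k (dY j f) + dX j (dY k f).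
Proof.
rewrite dY_sum_y raddfD /= dY_sum_y !dYX; congr (_ + _ + _).
by apply: eq_bigr => m _; rewrite !dYX.
Qed.

Lemma dYY_riemann i j k l : dY k (dY j (sp_riemann i l)) =
  2 * dX l (dY k (dY j (G i))) - dX k (dY j (dY l (G i)))
  - dX j (dY k (dY l (G i))) +
  \sum_(m < n)
   (2 * (dY k (dY j (G m)) * dY m (dY l (G i)) + dY j (G m) * dY k (dY m (dY l (G i)))
       + dY k (G m) * dY j (dY m (dY l (G i))) + G m * dY k (dY j (dY m (dY l (G i)))))
    - dX m (dY k (dY j (dY l (G i)))) * y m
    - (dY k (dY j (dY m (G i))) * dY l (G m) + dY j (dY m (G i)) * dY k (dY l (G m))
       + dY k (dY m (G i)) * dY j (dY l (G m)) + dY m (G i) * dY k (dY j (dY l (G m))))).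
Proof.
rewrite /sp_riemann !(raddfB, raddfD) /= !dY_natl dYY_sum_dX !dYY_sumM (dYX j) (dYX k).
rewrite !big_split /= -!mulr_sumr !sumrN !big_split /=; ring.
Qed.

Lemma cyc_riemann i j k l :
  cyc (sp_riemann i) j k l = - (3 * berwald_h0 j i k l).
Proof.
rewrite /cyc !dYY_riemann /berwald_h0 mulr_sumr -sumrN.
set S1 := \sum_(m < n) _; set S2 := \sum_(m < n) _; set S3 := \sum_(m < n) _.
transitivity (S1 + S2 + S3).
  by rewrite (dYY l j) (dYY k l) (dYY k j) (dYY j l); ring.
rewrite -!big_split; apply: eq_bigr => m _; rewrite /sp_berwald /=.
rewrite !(dYY m j) !(dYY m k) !(dYY m l) !(dYY l j) !(dYY l k) !(dYY k j).
ring.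
Qed.

(* W^i_k = R^i_k - R delta^i_k - tau_k y^i *)
Definition tau k : A :=
  c (n%:R + 1)^-1 * (\sum_(m < n) dY m (sp_riemann m k) - dY k sp_Rscal).

Lemma sp_weylE i k :
  sp_weyl i k = sp_riemann i k - sp_Rscal * (i == k)%:R - tau k * y i.
Proof.
rewrite /sp_weyl /sp_Amat /tau; congr (_ - _ * _ * _).
under eq_bigr do rewrite raddfB /= dYM dY_nat mulr0 addr0.
by rewrite sumrB (sum_delta (fun m => dY m sp_Rscal)).
Qed.

Hypothesis n_neq1 : n%:R - 1 != 0 :> R.

Lemma c_mulfV (a : R) : a != 0 -> c a * c a^-1 = 1.
Proof. by move=> a0; rewrite -rmorphM divff // rmorph1. Qed.

Lemma trace_riemann : \sum_(m < n) sp_riemann m m = (n%:R - 1) * sp_Rscal.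
Proof.
have := c_mulfV n_neq1; rewrite rmorphB rmorph_nat rmorph1 => E.
by rewrite /sp_Rscal mulrA E mul1r.
Qed.

Lemma c_n1V : (n%:R + 1) * c (n%:R + 1)^-1 = 1.
Proof.
by rewrite -[RHS](@c_mulfV (n%:R + 1)) ?rmorphD ?rmorph_nat ?rmorph1 ?natr1 ?pnatr_eq0.
Qed.

Lemma c_natV m : m.+1%:R * c m.+1%:R^-1 = 1.
Proof. by rewrite -[RHS](@c_mulfV m.+1%:R) ?rmorph_nat ?pnatr_eq0. Qed.

Lemma div_riemann k :
  \sum_(m < n) dY m (sp_riemann m k) = (n%:R + 1) * tau k + dY k sp_Rscal.
Proof. by rewrite /tau mulrA c_n1V mul1r subrK. Qed.

Lemma homog_tau k : homog 1 (tau k).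
Proof.
apply: (@homogM 0 1) (homog_c _) _; apply: homogD.
  by apply: homog_sum => m; exact/homog_dY/homog_riemann.
exact/homogN/homog_dY/homog_Rscal.
Qed.

Lemma tau_y : \sum_(k < n) tau k * y k = - sp_Rscal.
Proof.
have E1 : \sum_(k < n) (\sum_(m < n) dY m (sp_riemann m k)) * y k =
    - ((n%:R - 1) * sp_Rscal).
  under eq_bigr do rewrite mulr_suml.
  rewrite exchange_big -trace_riemann -sumrN; apply: eq_bigr => m _ /=.
  by apply/eqP; rewrite -addr_eq0 -dY_sum_y riemann_y raddf0.
have E2 : \sum_(k < n) dY k sp_Rscal * y k = 2 * sp_Rscal := homog_Rscal.
have -> : \sum_(k < n) tau k * y k = c (n%:R + 1)^-1 *
    (\sum_(k < n) (\sum_(m < n) dY m (sp_riemann m k)) * y k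
     - \sum_(k < n) dY k sp_Rscal * y k).
  by rewrite -sumrB mulr_sumr; apply: eq_bigr => k _; rewrite /tau; ring.
rewrite E1 E2.
transitivity (- ((n%:R + 1) * c (n%:R + 1)^-1 * sp_Rscal)); first by ring.
by rewrite c_n1V mul1r.
Qed.

Lemma homog_weyl i k : homog 2 (sp_weyl i k).
Proof.
rewrite sp_weylE; apply: homogD; first apply: homogD.
- exact: homog_riemann.
- exact/homogN/(@homogM 2 0)/homog_nat/homog_Rscal.
- exact/homogN/(@homogM 1 1)/homog_y/homog_tau.
Qed.

Lemma weyl_y i : \sum_(k < n) sp_weyl i k * y k = 0.
Proof.
have -> : \sum_(k < n) sp_weyl i k * y k = \sum_(k < n) sp_riemann i k * y k
    - sp_Rscal * (\sum_(k < n) y k * (k == i)%:R)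
    - (\sum_(k < n) tau k * y k) * y i.
  rewrite mulr_sumr mulr_suml -!sumrB; apply: eq_bigr => k _.
  by rewrite sp_weylE eq_sym; ring.
by rewrite riemann_y sum_delta tau_y; ring.
Qed.

Definition ric_sym j k : A := dY k (dY j sp_Rscal) + dY k (tau j) + dY j (tau k).

Lemma cyc_weyl i j k l : cyc (sp_weyl i) j k l =
  - (3 * berwald_h0 j i k l) - (i == l)%:R * ric_sym j k
  - (i == j)%:R * ric_sym l k - (i == k)%:R * ric_sym j l
  - (dY k (dY j (tau l)) + dY k (dY l (tau j)) + dY j (dY l (tau k))) * y i.
Proof.
have ddW p q r : dY p (dY q (sp_weyl i r)) = dY p (dY q (sp_riemann i r))
    - dY p (dY q sp_Rscal) * (i == r)%:R - (dY p (dY q (tau r)) * y i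
    + dY q (tau r) * (i == p)%:R + dY p (tau r) * (i == q)%:R).
  rewrite sp_weylE !raddfB /= !(raddfD, dYM) /= !dYy !dY_nat.
  by rewrite !raddf0; ring.
rewrite -cyc_riemann /cyc !ddW /ric_sym (dYY j l sp_Rscal); ring.
Qed.

Lemma weyl4_y i j k l : \sum_(m < n) dY k (sp_weyl4 j i m l) * y m =
  - (c 3^-1 * cyc (sp_weyl i) j k l).
Proof.
rewrite -mulrN -(cyc_contract _ _ _ (homog_weyl i) (weyl_y i)) mulr_sumr.
by apply: eq_bigr => m _; rewrite /sp_weyl4 dYcl mulrA.
Qed.

(* By the trace of the Berwald curvature, e_{jk} = 2 E_{jk}. *)
Let e := \sum_(m < n) dY m (G m).
Let e2 j k := dY j (dY k e).
Let e3 j k l := dY j (dY k (dY l e)).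

(* e_{jk|0} *)
Definition mean_h0 j k : A := \sum_(m < n)
  (dX m (e2 j k) * y m - 2 * (G m * dY m (e2 j k))
   - dY j (G m) * e2 m k - dY k (G m) * e2 j m).

(* e_{jkl|0} *)
Definition mean3_h0 j k l : A := \sum_(m < n)
  (dX m (e3 j k l) * y m - 2 * (G m * dY m (e3 j k l))
   - dY j (G m) * e3 m k l - dY k (G m) * e3 j m l - dY l (G m) * e3 j k m).

Lemma trace_berwald j k : \sum_(m < n) sp_berwald j m k m = e2 j k.
Proof. by rewrite /e2 /e !raddf_sum. Qed.

Lemma trace_berwald_h0 j k : \sum_(i < n) berwald_h0 j i k i = mean_h0 j k.
Proof.
have E : \sum_(m < n) \sum_(i < n) (dY m (G i) * sp_berwald j m k i
    - dY i (G m) * sp_berwald j i k m) = 0.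
  under eq_bigr do rewrite sumrB.
  by rewrite sumrB [X in _ - X]exchange_big subrr.
rewrite exchange_big -[RHS]addr0 -[X in _ + X]E -big_split.
apply: eq_bigr => m _ /=.
rewrite -!trace_berwald !raddf_sum /= !mulr_sumr mulr_suml -!sumrB -big_split.
by apply: eq_bigr => i _ /=; ring.
Qed.

Lemma ric_symE j k : ric_sym j k = - (3 * c (n%:R + 1)^-1 * mean_h0 j k).
Proof.
have : (n%:R + 1) * ric_sym j k = - (3 * mean_h0 j k).
  rewrite -trace_berwald_h0 mulr_sumr -sumrN.
  under [RHS]eq_bigr do rewrite -cyc_riemann.
  rewrite /cyc !big_split /= -!raddf_sum /= trace_riemann !div_riemann.
  have nB f : (n%:R - 1) * f = n%:R * f - f by rewrite mulrBl mul1r.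
  have nD f : (n%:R + 1) * f = n%:R * f + f by rewrite mulrDl mul1r.
  rewrite nB !nD !(raddfB, raddfD) /= !dY_natl /ric_sym (dYY j k sp_Rscal); ring.
move=> /(congr1 ( *%R (c (n%:R + 1)^-1))); rewrite mulrA [c _ * (_ + _)]mulrC c_n1V.
by rewrite mul1r => ->; ring.
Qed.

Lemma dY_mean_h0 j k l :
  dY l (mean_h0 j k) = mean3_h0 j k l + sp_hcov02 e2 j k l.
Proof.
rewrite /sp_hcov02 -(sum_delta (fun m => dX m (e2 j k)) l) -!sumrB.
rewrite -big_split raddf_sum; apply: eq_bigr => m _ /=.
rewrite !raddfB /= dY_natl !dYM dYy /e3 /e2 !dYX.
do 2!rewrite ?(dYY l m) ?(dYY k m) ?(dYY j m) ?(dYY l j) ?(dYY l k); ring.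
Qed.

Lemma hcov13_y (T : 'I_n -> 'I_n -> 'I_n -> 'I_n -> A) j i k l :
  \sum_(m < n) sp_hcov13 T j i k l m * y m = \sum_(m < n)
  (dX m (T j i k l) * y m - 2 * (G m * dY m (T j i k l))
   + dY m (G i) * T j m k l - dY j (G m) * T m i k l
   - dY k (G m) * T j i m l - dY l (G m) * T j i k m).
Proof.
have contract_y (N : 'I_n -> 'I_n -> A) v w : (forall r, \sum_(m < n) N m r * y m = w r) ->
    \sum_(m < n) (\sum_(r < n) N m r * v r) * y m = \sum_(r < n) w r * v r.
  move=> Ny; under eq_bigr do rewrite mulr_suml.
  rewrite exchange_big; apply: eq_bigr => r _; rewrite -Ny mulr_suml.
  by apply: eq_bigr => m _; rewrite mulrAC.
have N1 a r : \sum_(m < n) dY m (dY a (G r)) * y m = dY a (G r).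
  by rewrite (homog_dY a (homog_G r)) mul1r.
under eq_bigr do rewrite /sp_hcov13 !(mulrDl, mulNr).
rewrite !big_split /= !sumrN.
rewrite (contract_y _ _ _ G_homogeneous) !(contract_y _ _ _ (N1 _)).
rewrite (contract_y _ _ (fun r => dY r (G i))); last by move=> r; exact: N1.
under [X in _ - X + _ - _ - _ - _]eq_bigr do rewrite -mulrA.
by [].
Qed.

Lemma douglasE j i k l : sp_douglas j i k l = sp_berwald j i k l
  - c (n%:R + 1)^-1 * (e3 j k l * y i + e2 j k * (i == l)%:R
     + e2 k l * (i == j)%:R + e2 j l * (i == k)%:R).
Proof.
rewrite /sp_douglas -/e; congr (_ - _ * _).
rewrite !(raddfD, dYM) /= !dYy !dY_nat !raddf0 /e3 /e2; ring.
Qed.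

Lemma douglas_h0E j i k l : sp_douglas_h0 j i k l = berwald_h0 j i k l
  - c (n%:R + 1)^-1 * (mean3_h0 j k l * y i + (i == l)%:R * mean_h0 j k
     + (i == j)%:R * mean_h0 l k + (i == k)%:R * mean_h0 j l).
Proof.
(* [K] collects the contributions of the horizontal derivatives of y^i and of
   delta^i_l, which vanish. *)
pose K m := dY m (G i) * (e3 j k l * y m + e2 j k * (m == l)%:R
    + e2 k l * (m == j)%:R + e2 j l * (m == k)%:R)
  - (2 * (e3 j k l * G m) + e2 k l * dY j (G m) + e2 j l * dY k (G m)
     + e2 j k * dY l (G m)) * (m == i)%:R.
have K0 : \sum_(m < n) K m = 0.
  rewrite sumrB sum_delta.
  have -> : \sum_(m < n) dY m (G i) * (e3 j k l * y m + e2 j k * (m == l)%:R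
      + e2 k l * (m == j)%:R + e2 j l * (m == k)%:R) =
    e3 j k l * (\sum_(m < n) dY m (G i) * y m)
    + e2 j k * (\sum_(m < n) dY m (G i) * (m == l)%:R)
    + e2 k l * (\sum_(m < n) dY m (G i) * (m == j)%:R)
    + e2 j l * (\sum_(m < n) dY m (G i) * (m == k)%:R).
    by rewrite !mulr_sumr -!big_split; apply: eq_bigr => m _ /=; ring.
  by rewrite G_homogeneous !(sum_delta (fun m => dY m (G i))); ring.
rewrite /sp_douglas_h0 hcov13_y -[RHS]subr0.
rewrite -[X in _ = _ - X](mulr0 (c (n%:R + 1)^-1)) -[X in _ = _ - _ * X]K0.
rewrite /berwald_h0 /mean3_h0 /mean_h0 !(mulr_suml, mulr_sumr) -!big_split /=.
rewrite !(mulr_suml, mulr_sumr) -!sumrB. apply: eq_bigr => m _ /=.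
rewrite /K !douglasE !raddfB /= !dXcl !dYcl !(raddfD, dXM, dYM) /= !dXy !dX_nat.
rewrite !dYy !dY_nat (eq_sym m i) /e3 /e2.
rewrite !(dYY k l e) !(dYY m l e) !(dYY k m e); ring.
Qed.

Lemma thetaE j k l : sp_theta j k l = sp_hcov02 e2 j k l
  - c 3^-1 * ((n%:R + 1) * dY k (dY j (tau l - dY l sp_Rscal))).
Proof.
rewrite /sp_theta; congr (_ - _ * _); last first.
  have nD f : (n%:R + 1) * f = n%:R * f + f by rewrite mulrDl mul1r.
  have n2 f : (n%:R + 2) * f = n%:R * f + 2%:R * f by rewrite mulrDl.
  rewrite div_riemann !nD n2 !(raddfN, raddfD) /= !dY_natl.
  ring.
have E a b : sp_mean_berwald a b = c 2^-1 * e2 a b.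
  by rewrite /sp_mean_berwald trace_berwald.
rewrite /sp_hcov02 -(sum_delta (fun m => dX m (e2 j k)) l).
rewrite -(sum_delta (fun m => dX m (sp_mean_berwald j k)) l) -!sumrB mulr_sumr.
apply: eq_bigr => m _; rewrite !E dXcl dYcl -[RHS]mul1r.
by rewrite -[X in _ = X * _](c_natV 1); ring.
Qed.

Lemma weyl_douglas j i k l :
  \sum_(m < n) dY k (sp_weyl4 j i m l) * y m =
  sp_douglas_h0 j i k l - c (n%:R + 1)^-1 * sp_theta j k l * y i.
Proof.
have Et : dY k (dY l (tau j)) + dY j (dY l (tau k)) =
    - (3 * c (n%:R + 1)^-1 * (mean3_h0 j k l + sp_hcov02 e2 j k l))
    - dY k (dY j (dY l sp_Rscal)).
  have := congr1 (dY l) (ric_symE j k).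
  rewrite raddfN /= -mulrA dY_natl dYcl dY_mean_h0 /ric_sym !raddfD /=.
  rewrite (dYY l j (tau k)) !(dYY l k) (dYY l j sp_Rscal) => E.
  by apply: (addrI (dY k (dY j (dY l sp_Rscal)))); rewrite addrA E; ring.
rewrite weyl4_y cyc_weyl !ric_symE douglas_h0E thetaE !raddfB /=.
rewrite -(addrA (dY k (dY j (tau l)))) Et.
set t := c 3^-1; set u := c (n%:R + 1)^-1.
have t3 : 3 * t = 1 := c_natV 2.
have un : (n%:R + 1) * u = 1 := c_n1V.
apply/eqP; rewrite -subr_eq0; apply/eqP.
transitivity ((3 * t - 1) * (berwald_h0 j i k l
    - u * ((i == l)%:R * mean_h0 j k + (i == j)%:R * mean_h0 l k
           + (i == k)%:R * mean_h0 j l)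
    - u * (mean3_h0 j k l + sp_hcov02 e2 j k l) * y i)
  + (1 - (n%:R + 1) * u) *
    (t * (dY k (dY j (tau l)) - dY k (dY j (dY l sp_Rscal))) * y i)); first by ring.
by rewrite t3 un !subrr !mul0r addr0.
Qed.

End SprayAlgebra.

(** * The ring of smooth functions on an open set *)

Section DirectionSums.
Context {R : realType} {V : normedModType R}.

Lemma derive_sum_dir (U : set V) (f : V -> R) p m (a : 'I_m -> R)
    (v : 'I_m -> V) : open U -> is_Ck 1 U f -> U p ->
  'D_(\sum_(i < m) a i *: v i) f p = \sum_(i < m) 'D_(v i) f p * a i.
Proof.
move=> oU Cf Up; elim/big_rec2: _ => [|i D w _ <-]; first exact: derive0.
rewrite (deriveDdir _ _ oU Cf Up) derive_scale 1?mulrC //.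
exact: (is_Ck_derivable Cf Up).
Qed.

Lemma is_derive_linear (l : V -> R) p v :
  (forall a q r, l (a *: q + r) = a * l q + l r) -> is_derive p v l (l v).
Proof.
move=> linl.
have near_l : \forall h \near (0 : R)^',
    h^-1 *: ((l \o shift p) (h *: v) - l p) = l v.
  near=> h; have h0 : h != 0 by near: h; exact: nbhs_dnbhs_neq.
  by rewrite /= linl addrK [_ *: _]mulKf.
by split; [exact: is_cvg_near_cst near_l|exact: lim_near_cst near_l].
Unshelve. all: by end_near. Qed.

Lemma smooth_linear (l : V -> R) (U : set V) : continuous l ->
  (forall a q r, l (a *: q + r) = a * l q + l r) -> smooth_on U l.
Proof.
move=> cl linl k; apply: is_Ck_unfold => [p _|k' _ v]; first exact: cl.
split=> [p _|]; first by have [] := is_derive_linear p v linl.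
suff -> : 'D_v l = cst (l v) by exact: is_Ck_cst.
by apply/funext => p; have [] := is_derive_linear p v linl.
Qed.

End DirectionSums.

Section SmoothRing.
Context {R : realType} {V : normedModType R} {U : set V}.

(* The extension by the junk value 0 off [U]; only its values on [U] matter. *)
Definition extend0 (f : {p | U p} -> R) (p : V) : R :=
  if pselect (U p) is left h then f (exist U p h) else 0.

Lemma extend0E f p (h : U p) : extend0 f p = f (exist U p h).
Proof.
by rewrite /extend0; case: pselect => // h'; rewrite (Prop_irrelevance h' h).
Qed.

Definition smooth_pred (oU : open U) : {pred ({p | U p} -> R)} :=
  fun f => `[< smooth_on U (extend0 f) >].

(* Restricting functions to the subtype [{p | U p}] makes agreement on [U]
   coincide with Leibniz equality, so that derivations act on equalities. *)
Record smooth_fun (oU : open U) := SmoothFun {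
  smooth_val :> {p | U p} -> R;
  smooth_valP : smooth_val \in smooth_pred oU }.

Variable oU : open U.

HB.instance Definition _ := [isSub for @smooth_val oU].
HB.instance Definition _ := [Choice of smooth_fun oU by <:].

Lemma in_smooth_pred (f : {p | U p} -> R) (g : V -> R) : smooth_on U g ->
  (forall p (h : U p), g p = f (exist U p h)) -> f \in smooth_pred oU.
Proof.
move=> Cg gf; apply/asboolP => k; apply: eq_is_Ck (Cg k) => // p /set_mem Up.
by rewrite (extend0E _ Up).
Qed.

Lemma smooth_extend0 (f : smooth_fun oU) : smooth_on U (extend0 f).
Proof. by have /asboolP := smooth_valP f. Qed.

Lemma smooth_subring_closed : subring_closed (smooth_pred oU).
Proof.
have ext f : f \in smooth_pred oU -> smooth_on U (extend0 f) by move/asboolP.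
split=> [|f g /ext Cf /ext Cg|f g /ext Cf /ext Cg].
- by apply: (@in_smooth_pred _ (cst 1)) => // k; exact: is_Ck_cst.
- apply: (@in_smooth_pred _ (extend0 f + cst (-1) * extend0 g)) => [k|p h].
    by apply: is_CkD => //; apply: is_CkM => //; exact: is_Ck_cst.
  by rewrite !addrfctE !mulrfctE /cst /= !(extend0E _ h) mulN1r.
- apply: (@in_smooth_pred _ (extend0 f * extend0 g)) => [k|p h].
    exact: is_CkM.
  by rewrite !mulrfctE /= !(extend0E _ h).
Qed.

HB.instance Definition _ := GRing.SubChoice_isSubComPzRing.Build
  _ _ (smooth_fun oU) smooth_subring_closed.

Definition eval_at p (h : U p) (f : smooth_fun oU) : R := f (exist U p h).

Arguments eval_at : simpl never.

Lemma eval_at_zmod_morphism p (h : U p) : zmod_morphism (eval_at h).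
Proof. by []. Qed.

Lemma eval_at_monoid_morphism p (h : U p) : monoid_morphism (eval_at h).
Proof. by []. Qed.

HB.instance Definition _ p (h : U p) :=
  GRing.isZmodMorphism.Build _ _ (eval_at h) (eval_at_zmod_morphism h).
HB.instance Definition _ p (h : U p) :=
  GRing.isMonoidMorphism.Build _ _ (eval_at h) (eval_at_monoid_morphism h).

Definition represents (g : V -> R) (f : smooth_fun oU) :=
  forall p (h : U p), g p = eval_at h f.

Lemma smooth_funP (f g : smooth_fun oU) :
  (forall p (h : U p), eval_at h f = eval_at h g) -> f = g.
Proof. by move=> fg; apply/val_inj/funext => -[p h]; exact: fg. Qed.

Lemma represents_extend0 (f : smooth_fun oU) : represents (extend0 f) f.
Proof. by move=> p h; rewrite (extend0E _ h). Qed.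

Definition smooth_of (g : V -> R) (Cg : smooth_on U g) : smooth_fun oU :=
  SmoothFun (@in_smooth_pred (fun p => g (sval p)) g Cg (fun p h => erefl)).

Lemma represents_smooth_of g (Cg : smooth_on U g) : represents g (smooth_of Cg).
Proof. by []. Qed.

Lemma smooth_derive (f : V -> R) v : smooth_on U f -> smooth_on U ('D_v f).
Proof. by move=> Cf k; exact: is_Ck_derive (Cf k.+1). Qed.

Definition derivation v (f : smooth_fun oU) : smooth_fun oU :=
  smooth_of (smooth_derive v (smooth_extend0 f)).

Lemma represents_derive g f v :
  represents g f -> represents ('D_v g) (derivation v f).
Proof.
move=> gf p h; rewrite -(represents_smooth_of (smooth_derive v (smooth_extend0 f))).
apply: near_eq_derive; apply: (near_open_eq (f := g) oU _ h) => q /set_mem Uq.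
by rewrite (gf _ Uq) (represents_extend0 f Uq).
Qed.

Lemma derivation_zmod_morphism v : zmod_morphism (derivation v).
Proof.
move=> f g; apply: smooth_funP => p h; rewrite rmorphB /=.
have Cf := smooth_extend0 f 1; have Cg := smooth_extend0 g 1.
rewrite /eval_at /= -deriveB;
  [|exact: (is_Ck_derivable Cf)|exact: (is_Ck_derivable Cg)].
apply: near_eq_derive; apply: (near_open_eq oU _ h) => q /set_mem Uq.
by rewrite -[RHS]/(extend0 f q - extend0 g q) !(extend0E _ Uq).
Qed.

HB.instance Definition _ v :=
  GRing.isZmodMorphism.Build _ _ (derivation v) (derivation_zmod_morphism v).

Lemma derivationM v f g :
  derivation v (f * g) = derivation v f * g + f * derivation v g.
Proof.
apply: smooth_funP => p h; rewrite rmorphD !rmorphM /=.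
have Cf := smooth_extend0 f 1; have Cg := smooth_extend0 g 1.
rewrite -!(represents_derive _ (represents_extend0 _)) -!represents_extend0.
have -> : 'D_v (extend0 (f * g)) p = 'D_v (extend0 f * extend0 g) p.
  apply: near_eq_derive; apply: (near_open_eq oU _ h) => q /set_mem Uq.
  by rewrite /= !mulrfctE /= !(extend0E _ Uq).
rewrite deriveM; [|exact: (is_Ck_derivable Cf)|exact: (is_Ck_derivable Cg)].
by rewrite addrC; congr (_ + _); exact: mulrC.
Qed.

Lemma derivationC v w f :
  derivation v (derivation w f) = derivation w (derivation v f).
Proof.
have rf u z := represents_derive u (represents_derive z (represents_extend0 f)).
apply: smooth_funP => p h.
transitivity ('D_v ('D_w (extend0 f)) p); first exact: esym (rf v w p h).
rewrite (derive_comm v w oU (smooth_extend0 f 2) h).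
exact: (rf w v p h).
Qed.

Definition smooth_cst (a : R) : smooth_fun oU :=
  smooth_of (fun k => is_Ck_cst k U a).

Lemma smooth_cst_zmod_morphism : zmod_morphism smooth_cst.
Proof. by move=> a b; exact: smooth_funP. Qed.

Lemma smooth_cst_monoid_morphism : monoid_morphism smooth_cst.
Proof. by split=> [|a b]; exact: smooth_funP. Qed.

HB.instance Definition _ :=
  GRing.isZmodMorphism.Build _ _ smooth_cst smooth_cst_zmod_morphism.
HB.instance Definition _ :=
  GRing.isMonoidMorphism.Build _ _ smooth_cst smooth_cst_monoid_morphism.

Lemma represents_cst a : represents (cst a) (smooth_cst a).
Proof. by []. Qed.

Lemma derivation_cst v a : derivation v (smooth_cst a) = 0.
Proof.
apply: smooth_funP => p h; rewrite -(represents_derive _ (represents_cst a)).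
by rewrite derive_cst rmorph0.
Qed.

Lemma smooth_inverse (f : smooth_fun oU) :
  (forall p (h : U p), eval_at h f != 0) ->
  exists2 g : smooth_fun oU, f * g = 1 &
    forall p (h : U p), eval_at h g = (eval_at h f)^-1.
Proof.
move=> f0.
have CV : smooth_on U (fun p => (extend0 f p)^-1).
  move=> k; apply: is_CkV (smooth_extend0 f k) => // p /set_mem h.
  by rewrite (extend0E _ h); exact: f0.
have evV p (h : U p) : eval_at h (smooth_of CV) = (eval_at h f)^-1.
  by rewrite -(represents_smooth_of CV) (extend0E _ h).
exists (smooth_of CV) => //; apply: smooth_funP => p h.
by rewrite rmorphM rmorph1 /= evV divff.
Qed.

End SmoothRing.

(** * The slit tangent bundle of a chart *)

Definition slit_tangent (R : realType) (n : nat) (U : set 'rV[R]_n) :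
  set ('rV[R]_n * 'rV[R]_n) := [set p | U p.1 /\ p.2 != 0].

Lemma open_slit_tangent (R : realType) (n : nat) (U : set 'rV[R]_n) :
  open U -> open (slit_tangent U).
Proof.
move=> oU; have -> : slit_tangent U = fst @^-1` U `&` snd @^-1` (~` [set 0]).
  by apply/seteqP; split=> -[x y] /= [? /eqP].
apply: openI; apply: open_comp => //.
- by move=> p _; exact: cvg_fst.
- by move=> p _; exact: cvg_snd.
- apply/closed_openC/accessible_closed_set1/hausdorff_accessible.
  exact: norm_hausdorff.
Qed.

Section Transfer.
Variables (R : realType) (n : nat) (U : set 'rV[R]_n) (oU : open U).

Local Notation vec := 'rV[R]_n.
Local Notation TU := (slit_tangent U).
Local Notation oTU := (open_slit_tangent oU).
Local Notation sfun := (smooth_fun oTU).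
Local Notation cst_ := (@smooth_cst R (vec * vec)%type TU oTU).

Definition dXs (k : 'I_n) : {additive sfun -> sfun} :=
  @derivation R (vec * vec)%type TU oTU (delta_mx 0 k, 0).
Definition dYs (k : 'I_n) : {additive sfun -> sfun} :=
  @derivation R (vec * vec)%type TU oTU (0, delta_mx 0 k).

Definition trep (f : tfun R n) (s : sfun) :=
  represents (fun p => f p.1 p.2) s.

Lemma trep_dx k f s : trep f s -> trep (dx k f) (dXs k s).
Proof.
move=> /(represents_derive (delta_mx 0 k, 0)) fs [x y] h.
rewrite -fs /dx /derive /=.
set g1 := fun h => h^-1 *: _; set g2 := fun h => h^-1 *: _.
suff -> : g1 = g2 by [].
by apply/funext => t; rewrite /g1 /g2 /= scaler0 add0r.
Qed.

Lemma trep_dy k f s : trep f s -> trep (dy k f) (dYs k s).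
Proof.
move=> /(represents_derive (0, delta_mx 0 k)) fs [x y] h.
rewrite -fs /dy /derive /=.
set g1 := fun h => h^-1 *: _; set g2 := fun h => h^-1 *: _.
suff -> : g1 = g2 by [].
by apply/funext => t; rewrite /g1 /g2 /= scaler0 add0r.
Qed.

Lemma trepD f g s t : trep f s -> trep g t ->
  trep (fun x y => f x y + g x y) (s + t).
Proof. by move=> fs gt p h; rewrite rmorphD /= -fs -gt. Qed.

Lemma trepB f g s t : trep f s -> trep g t ->
  trep (fun x y => f x y - g x y) (s - t).
Proof. by move=> fs gt p h; rewrite rmorphB /= -fs -gt. Qed.

Lemma trepM f g s t : trep f s -> trep g t ->
  trep (fun x y => f x y * g x y) (s * t).
Proof. by move=> fs gt p h; rewrite rmorphM /= -fs -gt. Qed.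

Lemma trep_sum (f : 'I_n -> tfun R n) (s : 'I_n -> sfun) :
  (forall i, trep (f i) (s i)) ->
  trep (fun x y => \sum_(i < n) f i x y) (\sum_(i < n) s i).
Proof.
by move=> fs p h; rewrite rmorph_sum; apply: eq_bigr => i _; rewrite /= -fs.
Qed.

Lemma trep_cst a : trep (fun _ _ => a) (cst_ a).
Proof. by []. Qed.

Lemma trep_nat m : trep (fun _ _ => m%:R) m%:R.
Proof. by move=> p h; rewrite rmorph_nat. Qed.

Lemma smooth_coord (i : 'I_n) :
  smooth_on TU (fun p : vec * vec => p.2 0 i).
Proof.
apply: smooth_linear => [p|a q r]; last by rewrite /= !mxE.
apply: (@continuous_comp _ _ _ snd (fun M : vec => M 0 i)); first exact: cvg_snd.
exact: coord_continuous.
Qed.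

Definition coords (i : 'I_n) : sfun := smooth_of oTU (smooth_coord i).

Lemma trep_coords i : trep (fun _ y => y 0 i) (coords i).
Proof. by []. Qed.

Lemma dXs_coords k i : dXs k (coords i) = 0.
Proof.
apply: smooth_funP => p h; rewrite rmorph0.
rewrite -[LHS](represents_derive _ (represents_smooth_of oTU (smooth_coord i)) h).
have linl (a : R) (q r : vec * vec) :
    (a *: q + r).2 0 i = a * q.2 0 i + r.2 0 i by rewrite /= !mxE.
have [_ ->] := is_derive_linear p (delta_mx 0 k, 0) linl.
by rewrite /= mxE.
Qed.

Lemma dYs_coords k i : dYs k (coords i) = (i == k)%:R.
Proof.
apply: smooth_funP => p h; rewrite rmorph_nat.
rewrite -[LHS](represents_derive _ (represents_smooth_of oTU (smooth_coord i)) h).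
have linl (a : R) (q r : vec * vec) :
    (a *: q + r).2 0 i = a * q.2 0 i + r.2 0 i by rewrite /= !mxE.
have [_ ->] := is_derive_linear p (0, delta_mx 0 k) linl.
by rewrite /= mxE eqxx.
Qed.

Lemma dXsM k f g : dXs k (f * g) = dXs k f * g + f * dXs k g.
Proof. exact: derivationM. Qed.

Lemma dYsM k f g : dYs k (f * g) = dYs k f * g + f * dYs k g.
Proof. exact: derivationM. Qed.

Lemma dXs_cst k a : dXs k (cst_ a) = 0.
Proof. exact: derivation_cst. Qed.

Lemma dYs_cst k a : dYs k (cst_ a) = 0.
Proof. exact: derivation_cst. Qed.

Lemma dYs_dXs k l f : dYs k (dXs l f) = dXs l (dYs k f).
Proof. exact: derivationC. Qed.

Lemma dYs_dYs k l f : dYs k (dYs l f) = dYs l (dYs k f).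
Proof. exact: derivationC. Qed.

Local Notation shomog := (@homog sfun n dYs coords).

Lemma sum_coords_direction (y : vec) :
  \sum_(m < n) y 0 m *: ((0, delta_mx 0 m) : vec * vec) = (0, y).
Proof.
rewrite [in RHS](row_sum_delta y).
rewrite (big_morph (fun v => (0, v) : vec * vec) (id1 := 0) (op1 := +%R)) //.
  by apply: eq_bigr => m _; congr (_, _); rewrite scaler0.
by move=> u v; congr (_, _); rewrite addr0.
Qed.

Lemma derive_homogeneous1 (F : tfun R n) x y :
  (forall a : R, 0 < a -> F x (a *: y) = a * F x y) ->
  'D_((0, y) : vec * vec) (fun p => F p.1 p.2) (x, y) = F x y.
Proof.
move=> homF; rewrite -(scale1r ((0, y) : vec * vec)) derive_line.
have [dl Dl] := @is_derive_linear R R^o (fun t : R => t * F x y) 0 1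
  (fun a q r => etrans (mulrDl _ _ _) (congr1 (+%R^~ _) (esym (mulrA _ _ _)))).
rewrite (@near_eq_derive _ _ _ _ ((fun t : R => t * F x y) + cst (F x y))).
  rewrite deriveD; [|exact: dl|exact: derivable_cst].
  by rewrite Dl derive_cst addr0 mul1r.
have : \forall t \near (0 : R), - 1 < t.
  by apply: lt_nbhsr; rewrite oppr_lt0.
apply: filterS => t t1.
rewrite addrfctE /cst /= scaler0 add0r -[X in _ + X]scale1r -scalerDl homF; last by lra.
by rewrite mulrDl mul1r.
Qed.

Section Metric.
Variables (F : tfun R n) (F_finsler : finsler_on U F).

Lemma finsler_smooth : smooth_on TU (fun p => F p.1 p.2).
Proof. by case: F_finsler. Qed.

Definition sF : sfun := smooth_of oTU finsler_smooth.

Lemma trep_Fsq : trep (Fsq F) (sF * sF).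
Proof. by move=> p h; rewrite rmorphM /= /Fsq expr2. Qed.

Lemma homog_sF : shomog 1 sF.
Proof.
have repF := represents_smooth_of oTU finsler_smooth.
apply: smooth_funP => -[x y] h; have [/= Ux y0] := h.
rewrite mul1r rmorph_sum -[RHS](repF _ h) /=.
transitivity ('D_((0, y) : vec * vec) (fun p => F p.1 p.2) (x, y)); last first.
  by apply: derive_homogeneous1 => a a0; case: F_finsler => _ _ ->.
rewrite -sum_coords_direction.
rewrite (derive_sum_dir _ _ oTU (finsler_smooth 1)) //.
apply: eq_bigr => m _.
rewrite -[LHS]/(eval_at h (dYs m sF) * eval_at h (coords m)); congr (_ * _).
by rewrite -[LHS](represents_derive _ repF).
Qed.

Lemma homog_sL : shomog 2 (sF * sF).
Proof. exact: (homogM dYsM homog_sF homog_sF). Qed.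

Definition sg i j : sfun := cst_ 2^-1 * dYs j (dYs i (sF * sF)).

Lemma trep_fundamental i j : trep (fundamental F i j) (sg i j).
Proof.
by apply: trepM; [exact: trep_cst|exact/trep_dy/trep_dy/trep_Fsq].
Qed.

Lemma homog_sg i j : shomog 0 (sg i j).
Proof.
apply: (homogM (d := 0) (e := 0) dYsM); first exact: homog_c dYs_cst _.
by do 2!apply: (homog_dY dYsM dYs_cst dYs_dYs dYs_coords); exact: homog_sL.
Qed.

Definition smx : 'M[sfun]_n := \matrix_(i, j) sg i j.

Lemma eval_smx x y (h : TU (x, y)) :
  map_mx (eval_at (oU := oTU) h) smx = fundamental_mx F x y.
Proof. by apply/matrixP => i j; rewrite !mxE -trep_fundamental. Qed.

Lemma det_fundamental_neq0 x y : TU (x, y) -> \det (fundamental_mx F x y) != 0.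
Proof.
move=> [/= Ux y0]; apply/negP => /det0P[v v0 vA].
have [_ _ _ /(_ x y v Ux y0 v0)] := F_finsler.
rewrite exchange_big big1 ?ltxx // => j _ /=.
have /matrixP/(_ 0 j) := vA; rewrite !mxE => vAj.
transitivity ((\sum_(i < n) v 0 i * fundamental_mx F x y i j) * v 0 j).
  by rewrite mulr_suml; apply: eq_bigr => i _; rewrite mxE; ring.
by rewrite vAj mul0r.
Qed.

Lemma spray_smooth : exists sG : 'I_n -> sfun,
  (forall i, trep (spray F i) (sG i)) /\ (forall i, shomog 2 (sG i)).
Proof.
have [d detd evd] : exists2 d : sfun, \det smx * d = 1 &
    forall p (h : TU p), eval_at h d = (eval_at h (\det smx))^-1.
  apply: smooth_inverse => -[x y] h.
  by rewrite -det_map_mx eval_smx det_fundamental_neq0.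
pose ginv i l := d * \adj smx i l.
have trep_ginv i l :
    trep (fun x y => invmx (fundamental_mx F x y) i l) (ginv i l).
  move=> [x y] h; have det0 := det_fundamental_neq0 h.
  rewrite rmorphM /= evd -det_map_mx eval_smx /invmx unitmxE unitfE det0 mxE.
  by congr (_ * _); rewrite -(eval_smx h) -map_mx_adj mxE.
have homog_ginv : forall i l, shomog 0 (ginv i l).
  apply: (homog_inverse dYsM dYs_cst homog_sg) => i k.
    have /matrixP/(_ i k) := mul_adj_mx smx; rewrite !mxE => E.
    transitivity (d * (\det smx *+ (i == k))); last first.
      by rewrite -[RHS]mulr1 -[X in _ = _ * X]detd -mulr_natl; ring.
    rewrite -E mulr_sumr; apply: eq_bigr => j _.
    by rewrite /ginv -mulrA; congr (_ * (_ * _)); rewrite [RHS]mxE.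
  have /matrixP/(_ i k) := mul_mx_adj smx; rewrite !mxE => E.
  transitivity (d * (\det smx *+ (i == k))); last first.
      by rewrite -[RHS]mulr1 -[X in _ = _ * X]detd -mulr_natl; ring.
  rewrite -E mulr_sumr; apply: eq_bigr => j _.
  by rewrite /ginv mulrCA; congr (_ * (_ * _)); rewrite [RHS]mxE.
exists (fun i => cst_ 4^-1 * \sum_(l < n) ginv i l *
  (\sum_(k < n) dYs l (dXs k (sF * sF)) * coords k - dXs l (sF * sF))).
split=> i; last first.
  apply: (homog_metric_spray dXsM dYsM dXs_cst dYs_cst dYs_dXs dYs_dYs
    dXs_coords dYs_coords homog_sL) => l; exact: homog_ginv.
apply: trepM; first exact: trep_cst.
apply: trep_sum => l; apply: trepM; first exact: trep_ginv.
apply: trepB; last exact/trep_dx/trep_Fsq.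
apply: trep_sum => k; apply: trepM; last exact: trep_coords.
exact/trep_dy/trep_dx/trep_Fsq.
Qed.

End Metric.

Section Tensors.
Variables (F : tfun R n) (sG : 'I_n -> sfun).
Hypothesis trep_spray : forall i, trep (spray F i) (sG i).

Local Notation weyl4_ := (sp_weyl4 cst_ dXs dYs coords sG).

Ltac trep_step := lazymatch goal with
  | |- forall i, trep _ _ => move=> ?
  | |- trep _ (sG _) => exact: trep_spray
  | |- trep _ (_ + - _) => apply: trepB
  | |- trep _ (_ + _) => apply: trepD
  | |- trep _ (_ * _) => apply: trepM
  | |- trep _ (bigop.body _ _ _) => apply: trep_sum
  | |- trep _ (coords _) => exact: trep_coords
  | |- trep _ (_%:R) => exact: trep_nat
  | |- trep _ (GRing.RMorphism.sort _ _) => exact: trep_cst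
  | |- trep _ (Algebra.Additive.sort (dXs _) _) => apply: trep_dx
  | |- trep _ (Algebra.Additive.sort (dYs _) _) => apply: trep_dy
  end.

Lemma trep_riemann i k : trep (riemann F i k) (sp_riemann dXs dYs coords sG i k).
Proof. by rewrite /riemann /sp_riemann; repeat trep_step. Qed.

Lemma trep_Rscal : trep (Rscal F) (sp_Rscal cst_ dXs dYs coords sG).
Proof.
by rewrite /Rscal /sp_Rscal; repeat first [trep_step|exact: trep_riemann].
Qed.

Lemma trep_weyl i k : trep (weyl F i k) (sp_weyl cst_ dXs dYs coords sG i k).
Proof.
have trep_Amat a b : trep (Amat F a b) (sp_Amat cst_ dXs dYs coords sG a b).
  apply: trepB; first exact: trep_riemann.
  by apply: trepM; [exact: trep_Rscal|exact: trep_nat].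
by rewrite /weyl /sp_weyl; repeat first [trep_step|exact: trep_Amat].
Qed.

Lemma trep_weyl4 j i k l : trep (weyl4 F j i k l) (weyl4_ j i k l).
Proof.
by rewrite /weyl4 /sp_weyl4; repeat first [trep_step|exact: trep_weyl].
Qed.

Lemma trep_hcov02 (T : 'I_n -> 'I_n -> tfun R n) (T' : 'I_n -> 'I_n -> sfun) :
  (forall j k, trep (T j k) (T' j k)) ->
  forall j k m, trep (hcov02 F T j k m) (sp_hcov02 dXs dYs sG T' j k m).
Proof.
move=> TT' j k m; rewrite /hcov02 /sp_hcov02 /Ncoef /Gcoef.
by repeat first [trep_step|exact: TT'].
Qed.

Lemma trep_hcov13 (T : 'I_n -> 'I_n -> 'I_n -> 'I_n -> tfun R n)
    (T' : 'I_n -> 'I_n -> 'I_n -> 'I_n -> sfun) :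
  (forall j i k l, trep (T j i k l) (T' j i k l)) ->
  forall j i k l m,
    trep (hcov13 F T j i k l m) (sp_hcov13 dXs dYs sG T' j i k l m).
Proof.
move=> TT' j i k l m; rewrite /hcov13 /sp_hcov13 /Ncoef /Gcoef.
by repeat first [trep_step|exact: TT'].
Qed.

Lemma trep_douglas_h0 j i k l : trep (douglas_h0 F j i k l)
  (sp_douglas_h0 cst_ dXs dYs coords sG j i k l).
Proof.
have trep_douglas a b d e :
    trep (douglas F a b d e) (sp_douglas cst_ dYs coords sG a b d e).
  by rewrite /douglas /sp_douglas /berwald /sp_berwald; repeat trep_step.
apply: trep_sum => m; apply: trepM; last exact: trep_coords.
exact: trep_hcov13.
Qed.

Lemma trep_theta j k l :
  trep (theta F j k l) (sp_theta cst_ dXs dYs coords sG j k l).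
Proof.
have trep_mean a b : trep (mean_berwald F a b) (sp_mean_berwald cst_ dYs sG a b).
  rewrite /mean_berwald /sp_mean_berwald /berwald /sp_berwald.
  by repeat trep_step.
rewrite /theta /sp_theta; apply: trepB.
  by apply: trepM; [exact: trep_nat|exact: trep_hcov02].
by repeat first [trep_step|exact: trep_riemann|exact: trep_Rscal].
Qed.

End Tensors.

End Transfer.

Lemma finsler_weyl_douglas (R : realType) (n : nat) (U : set 'rV[R]_n)
    (F : tfun R n) : open U -> (2 <= n)%N -> finsler_on U F ->
  forall x y (j i k l : 'I_n), U x -> y != 0 ->
  \sum_(m < n) dy k (weyl4 F j i m l) x y * y 0 m =
  douglas_h0 F j i k l x y - (n%:R + 1)^-1 * theta F j k l x y * y 0 i.
Proof.
move=> oU n2 FF x y j i k l Ux y0.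
have [sG [tG hG]] := spray_smooth oU FF.
have n1 : n%:R - 1 != 0 :> R.
  by rewrite subr_eq0 -[1](mulr1n 1) eqr_nat gtn_eqF.
have := weyl_douglas (@dXsM _ _ _ oU) (@dYsM _ _ _ oU) (@dXs_cst _ _ _ oU)
  (@dYs_cst _ _ _ oU) (@dYs_dXs _ _ _ oU) (@dYs_dYs _ _ _ oU)
  (@dXs_coords _ _ _ oU) (@dYs_coords _ _ _ oU) hG n1 j i k l.
set lhs := (X in X = _); set rhs := (X in _ = X) => E.
have h : slit_tangent U (x, y) by [].
have tl : trep (fun x y => \sum_(m < n) dy k (weyl4 F j i m l) x y * y 0 m) lhs.
  apply: trep_sum => m; apply: trepM; last exact: trep_coords.
  exact/trep_dy/trep_weyl4.
have tr : trep (fun x y => douglas_h0 F j i k l x y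
    - (n%:R + 1)^-1 * theta F j k l x y * y 0 i) rhs.
  apply: trepB; first exact: trep_douglas_h0.
  apply: trepM; last exact: trep_coords.
  by apply: trepM; [exact: trep_cst|exact: trep_theta].
transitivity (eval_at h lhs); first exact: (tl (x, y) h).
by rewrite E; symmetry; exact: (tr (x, y) h).
Qed.

Theorem theorem2p3 (R : realType) (n : nat) (M : topologicalType)
    (A : smooth_manifold R n M) (F : chart A -> tfun R n)
    (n_ge2 : (2 <= n)%N) (F_finsler : finsler_metric F)
    (a : chart A) (x y : 'rV[R]_n)
    (x_in : (chart_map a @` chart_dom a) x) (y_neq0 : y != 0) (i j k l : 'I_n) :
  \sum_(m < n) dy k (weyl4 (F a) j i m l) x y * y 0 m =
  douglas_h0 (F a) j i k l x y
  - (n%:R + 1)^-1 * theta (F a) j k l x y * y 0 i.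
Proof.
apply: finsler_weyl_douglas (x_in) y_neq0 => //; first exact: chart_map_open.
by case: F_finsler.
Qed.
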